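(* Let $T>0$, let $U\subset\mathbb{R}^m$ be closed and nonempty, and let $X\subset C^0(\mathbb{R}^n\times U;\mathbb{R}^n)$ be compact with respect to $\|\cdot\|_\infty$. Suppose that $f:\mathbb{R}^n\times U\to\mathbb{R}^n$, $f\in X$, is a Lipschitz continuous function, and that the running cost $\ell:\mathbb{R}^n\times U\to\mathbb{R}$ and the terminal cost $h:\mathbb{R}^n\to\mathbb{R}$ are Lipschitz continuous in the first argument with constants $L_\ell$ and $L_h$ respectively, i.e. $|\ell(x,u)-\ell(y,u)|\le L_\ell|x-y|$ and $|h(x)-h(y)|\le L_h|x-y|$ for all $x,y\in\mathbb{R}^n$, $u\in U$. Let $\{\pi^N\}_{N\in\mathbb{N}}$ be a sequence of probability distributions on $X$ such that $W_1(\pi^N,\delta_f)\to0$ as $N\to\infty$. Then the value function $V_{\pi^N}$ of the averaged optimal control problem associated with $\pi^N$ converges, uniformly on $[0,T]\times\mathbb{R}^n$, to the value function $V$ of the classical optimal control problem with dynamics $f$ (both value functions being defined in the context).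
   Context: Notation: $|\cdot|$ is the Euclidean norm and $\|\cdot\|_\infty$ is the sup norm over the domain of the function. $X$ is a compact metric space for the distance $\|g-f\|_\infty$ (in particular this is finite for $f,g\in X$), and probability distributions on $X$ are Borel probability measures; $\delta_f$ is the Dirac mass at $f$. Wasserstein distance: for probability distributions $\pi,\pi'$ on $X$, $$W_1(\pi,\pi')=\inf_{\gamma\in\Gamma(\pi,\pi')}\int_{X\times X}\|g_1-g_2\|_\infty\,d\gamma(g_1,g_2),$$ where $\Gamma(\pi,\pi')$ is the set of probability measures on $X\times X$ with marginals $\pi$ and $\pi'$. For $s\in[0,T]$ let $\mathcal{U}_s=\{u:[s,T]\to U\text{ measurable}\}$ be the set of admissible controls. For $g\in X$, $x_0\in\mathbb{R}^n$, $u\in\mathcal{U}_s$, let $x^g$ denote the (absolutely continuous) solution of $$\dot x^g(t)=g(x^g(t),u(t)),\quad t\in[s,T],\qquad x^g(s)=x_0.$$ Classical problem with dynamics $f$ (Problem A): $$J_{s,x_0}[u]=\int_s^T\ell(x^f(t),u(t))\,dt+h(x^f(T)),\qquad V(s,x_0)=\inf_{u\in\mathcal{U}_s}J_{s,x_0}[u].$$ Averaged problem associated with a probability distribution $\pi$ on $X$ (Problem B): $$J_{\pi,s,x_0}[u]=\int_X\Big[\int_s^T\ell(x^g(t),u(t))\,dt+h(x^g(T))\Big]d\pi(g),\qquad V_\pi(s,x_0)=\inf_{u\in\mathcal{U}_s}J_{\pi,s,x_0}[u],$$ for $(s,x_0)\in[0,T]\times\mathbb{R}^n$, where the same control $u$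 is applied to every dynamics $g\in X$. Standing assumptions: for every $g\in X$, every $(s,x_0)$ and every $u\in\mathcal{U}_s$ the Cauchy problem above has a unique solution on $[s,T]$; the cost functionals are well defined and finite (all integrals appearing in them make sense), and the value functions are real-valued. *)

(* Defs.v *)
From HB Require Import structures.
From mathcomp Require Import all_boot all_order all_algebra.
From mathcomp Require Import all_classical all_reals all_analysis.
From mathcomp Require Import ring lra.

Set Implicit Arguments.
Unset Strict Implicit.
Unset Printing Implicit Defensive.
Import Order.TTheory GRing.Theory Num.Theory.
Import numFieldNormedType.Exports.

Local Open Scope classical_set_scope.
Local Open Scope ring_scope.

(* The library's norm on ['rV[R]_n] is the max norm; it induces the usual
   topology and derivatives, but all metric quantities use [enorm]. *)
Definition enorm {R : realType} {n : nat} (x : 'rV[R]_n) : R :=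
  Num.sqrt (\sum_(i < n) x 0 i ^+ 2).

Section enorm_theory.
Context {R : realType} {n : nat}.
Implicit Types x y : 'rV[R]_n.

Lemma enorm_ge0 x : 0 <= enorm x.
Proof. exact: sqrtr_ge0. Qed.

Lemma enorm0 : enorm (0 : 'rV[R]_n) = 0.
Proof.
by rewrite /enorm big1 ?sqrtr0// => i _; rewrite mxE expr0n.
Qed.

Lemma enormN x : enorm (- x) = enorm x.
Proof. by rewrite /enorm; under eq_bigr do rewrite mxE sqrrN. Qed.

Lemma sqr_enorm x : enorm x ^+ 2 = \sum_(i < n) x 0 i ^+ 2.
Proof. by rewrite sqr_sqrtr// sumr_ge0// => i _; exact: sqr_ge0. Qed.

Lemma cauchy_schwarz_enorm x y :
  \sum_(i < n) x 0 i * y 0 i <= enorm x * enorm y.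
Proof.
set a := enorm x; set b := enorm y; set c := \sum_(i < n) _.
have key : 2 * (a * b) * c <= 2 * (a * b) * (a * b).
  have : 0 <= \sum_(i < n) (b * x 0 i - a * y 0 i) ^+ 2.
    by rewrite sumr_ge0// => i _; exact: sqr_ge0.
  have -> : \sum_(i < n) (b * x 0 i - a * y 0 i) ^+ 2 =
            2 * (a * b) * (a * b) - 2 * (a * b) * c.
    transitivity (b ^+ 2 * (\sum_(i < n) x 0 i ^+ 2) +
        a ^+ 2 * (\sum_(i < n) y 0 i ^+ 2) - 2 * (a * b) * c).
      rewrite /c 3!mulr_sumr -sumrN -!big_split/=.
      by apply: eq_bigr => i _; ring.
    by rewrite -!sqr_enorm -/a -/b; ring.
  by rewrite subr_ge0.
have [ab0|] := ltP 0 (a * b); first by move: key; rewrite ler_pM2l// pmulr_rgt0.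
have a0 : 0 <= a by exact: enorm_ge0.
have b0 : 0 <= b by exact: enorm_ge0.
have zero z : enorm z = 0 -> forall i, (z : 'rV[R]_n) 0 i = 0.
  move=> z0 i; have /eqP := sqr_enorm z.
  rewrite z0 expr0n eq_sym psumr_eq0 => [/allP/(_ i)|j _]; last exact: sqr_ge0.
  by rewrite mem_index_enum => /(_ isT); rewrite sqrf_eq0 => /eqP.
move=> abn; have /eqP : a * b = 0 by apply/le_anti; rewrite abn mulr_ge0.
rewrite mulf_eq0 => /orP[] /eqP z0.
- by rewrite z0 mul0r /c big1// => i _; rewrite (zero x)// mul0r.
- by rewrite z0 mulr0 /c big1// => i _; rewrite (zero y)// mulr0.
Qed.

Lemma enormD x y : enorm (x + y) <= enorm x + enorm y.
Proof.
rewrite -(@ler_pXn2r _ 2)// ?nnegrE ?addr_ge0 ?enorm_ge0//.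
rewrite sqr_enorm sqrrD !sqr_enorm -lerBlDr.
rewrite [leLHS](_ : _ = \sum_(i < n) x 0 i ^+ 2 +
    (\sum_(i < n) x 0 i * y 0 i) *+ 2).
  by rewrite lerD2l lerMn2r/= cauchy_schwarz_enorm.
rewrite -sumrMnl -sumrN -!big_split/=.
by apply: eq_bigr => i _; rewrite mxE; ring.
Qed.

End enorm_theory.

(* Dynamics $g : \mathbb R^n \times U \to \mathbb R^n$; the control set [U] is
   used as a type, so that equality of dynamics is equality on
   $\mathbb R^n \times U$. *)
Definition dynamics {R : realType} (n m : nat) (U : set 'rV[R]_m) : Type :=
  'rV[R]_n * U -> 'rV[R]_n.

Definition sup_dist {R : realType} {n m : nat} {U : set 'rV[R]_m}
    (g1 g2 : dynamics n U) : \bar R :=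
  ereal_sup [set (enorm (g1 z - g2 z))%:E | z in [set: 'rV[R]_n * U]].

(* The topology on [dynamics] is that of $\|g_1 - g_2\|_\infty$.  The functions
   may be unbounded, so the distance is extended-valued on the whole type. *)
Section dynamics_topology.
Context {R : realType} {n m : nat} {U : set 'rV[R]_m}.
Local Notation D := (dynamics n U).

Definition dynamics_ball (g : D) (e : R) : set D :=
  [set g' | (sup_dist g g' < e%:E)%E].

Definition dynamics_ent : set_system (D * D) := entourage_ dynamics_ball.

HB.instance Definition _ := gen_eqMixin D.
HB.instance Definition _ := gen_choiceMixin D.
HB.instance Definition _ := hasNbhs.Build D (nbhs_ dynamics_ent).

Let ball_center (g : D) (e : R) : 0 < e -> dynamics_ball g e g.
Proof.
move=> e0; apply: (@le_lt_trans _ _ 0%E); last by rewrite lte_fin.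
by apply: ge_ereal_sup => _ [z _ <-]; rewrite subrr enorm0.
Qed.

Let ball_sym (g g' : D) (e : R) : dynamics_ball g e g' -> dynamics_ball g' e g.
Proof.
rewrite /dynamics_ball/=; congr (_ < _)%E; congr ereal_sup.
by apply: eq_imagel => z _; rewrite -enormN opprB.
Qed.

Let ball_triangle (g1 g2 g3 : D) (e1 e2 : R) :
  dynamics_ball g1 e1 g2 -> dynamics_ball g2 e2 g3 ->
  dynamics_ball g1 (e1 + e2) g3.
Proof.
rewrite /dynamics_ball/= => d12 d23.
apply: (@le_lt_trans _ _ (sup_dist g1 g2 + sup_dist g2 g3)%E); last first.
  by rewrite EFinD; exact: lteD.
apply: ge_ereal_sup => _ [z _ <-].
apply: (@le_trans _ _ ((enorm (g1 z - g2 z))%:E + (enorm (g2 z - g3 z))%:E)%E).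
  by rewrite -EFinD lee_fin (le_trans _ (enormD _ _))// addrA subrK.
by apply: leeD; apply: ereal_sup_ubound; exists z.
Qed.

HB.instance Definition _ := @Nbhs_isPseudoMetric.Build R D
  dynamics_ent erefl dynamics_ball ball_center ball_sym ball_triangle erefl.

End dynamics_topology.

(* [measurableType]s carry a base point: [f] serves as the (irrelevant) base
   point of the space [X]. *)
Definition pointed_at {T : Type} (t : T) : Type := T.

HB.instance Definition _ (T : topologicalType) (t : T) :=
  Topological.copy (pointed_at t) T.
HB.instance Definition _ (T : topologicalType) (t : T) :=
  isPointed.Build (pointed_at t) t.

Definition borel {T : topologicalType} (t : T) :=
  g_sigma_algebraType (@open (pointed_at t)).

Definition borel_rV {R : realType} {m : nat} :=
  g_sigma_algebraType (@open 'rV[R]_m).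

Section wasserstein.
Context {R : realType} {n m : nat} {U : set 'rV[R]_m}.
Context {X : set (dynamics n U)} {f : X}.
Local Notation S := (borel f).
Local Open Scope ereal_scope.

Definition coupling (pi pi' : probability S R) : set (probability (S * S)%type R) :=
  [set gamma | (forall A, measurable A -> gamma (fst @^-1` A) = pi A) /\
               (forall A, measurable A -> gamma (snd @^-1` A) = pi' A)].

Definition W1 (pi pi' : probability S R) : \bar R :=
  ereal_inf [set \int[gamma]_p sup_dist (set_val p.1) (set_val p.2)
            | gamma in coupling pi pi'].

End wasserstein.

Definition absolutely_continuous {R : realType} {n : nat} (a b : R)
    (x : R -> 'rV[R]_n) : Prop :=
  forall e : R, 0 < e -> exists2 d : R, 0 < d &
    forall (k : nat) (l r : 'I_k -> R),
      (forall i, [/\ a <= l i, l i <= r i & r i <= b]) ->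
      trivIset setT (fun i => `]l i, r i[%classic) ->
      \sum_i (r i - l i) < d ->
      \sum_i enorm (x (r i) - x (l i)) < e.

(* $\mathbb R$ with the $\sigma$-algebra of Lebesgue measurable sets. *)
Notation lebesgue_measurableType R :=
  (caratheodory_type ((@wlength R idfun)^*)%mu).

Section control.
Context {R : realType} {n m : nat} {U : set 'rV[R]_m}.
Variable T : R.
Local Notation leb := (@completed_lebesgue_measure R).

(* Controls and trajectories are functions on the whole of [R], of which only
   the values on $[s, T]$ matter.  "Measurable" on $[s, T]$ means Lebesgue
   measurable, whence the completed measure. *)
Definition admissible (s : R) : set (R -> U) :=
  [set u | @measurable_fun _ _ (lebesgue_measurableType R) (@borel_rV R m)
             `[s, T]%classic (fun t => set_val (u t))].

Definition is_solution (g : dynamics n U) (s : R) (x0 : 'rV[R]_n) (u : R -> U)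
    (x : R -> 'rV[R]_n) : Prop :=
  [/\ absolutely_continuous s T x, x s = x0 &
      {ae leb, forall t : R, t \in `[s, T] -> is_derive t 1 x (g (x t, u t))}].

Definition unique_solution (g : dynamics n U) (s : R) (x0 : 'rV[R]_n)
    (u : R -> U) : Prop :=
  exists2 x, is_solution g s x0 u x &
    forall y, is_solution g s x0 u y -> {in `[s, T], y =1 x}.

(* Under [unique_solution], determined on $[s, T]$; [cst 0] is the dummy value
   for when there is no solution. *)
Definition trajectory (g : dynamics n U) (s : R) (x0 : 'rV[R]_n) (u : R -> U) :
    R -> 'rV[R]_n :=
  xget (cst 0) [set x | is_solution g s x0 u x].

Variables (ell : 'rV[R]_n * U -> R) (h : 'rV[R]_n -> R).

Definition running_cost g s x0 u (t : R) : R :=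
  ell (trajectory g s x0 u t, u t).

Definition cost (g : dynamics n U) s x0 u : R :=
  \int[leb]_(t in `[s, T]%classic) running_cost g s x0 u t +
  h (trajectory g s x0 u T).

Definition value (g : dynamics n U) s x0 : \bar R :=
  ereal_inf [set (cost g s x0 u)%:E | u in admissible s].

Section averaged.
Context {X : set (dynamics n U)} {f : X}.

Definition avg_cost (pi : probability (borel f) R) s x0 u : R :=
  \int[pi]_g cost (set_val g) s x0 u.

Definition avg_value (pi : probability (borel f) R) s x0 : \bar R :=
  ereal_inf [set (avg_cost pi s x0 u)%:E | u in admissible s].

End averaged.

End control.

(* Main.v *)
Require Import Defs.
From HB Require Import structures.
From mathcomp Require Import all_boot all_order all_algebra.
From mathcomp Require Import all_classical all_reals all_analysis.
From mathcomp Require Import measurable_realfun.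
From mathcomp Require Import ring lra.
Import Order.TTheory GRing.Theory Num.Theory.
Import numFieldNormedType.Exports.
Local Open Scope classical_set_scope.
Local Open Scope ring_scope.

(** For a fixed control, the cost is a Lipschitz function of the dynamics at
    [f]: there is a constant [C], depending only on [T] and on the Lipschitz
    constants of [f], [ell] and [h], such that
    [|cost g - cost f| <= C * sup_dist g f] for every [g] in [X], every initial
    datum [(s, x0)] and every control ([cost_dist]).  Averaging over a coupling
    of [pi] with the Dirac mass at [f] gives
    [|avg_cost pi - cost f| <= C * W1 pi \d_f] with the same [C]
    ([mean_dist_le_W1]).  Infima over the same set of controls of two functions
    that differ by at most [d] also differ by at most [d] ([ereal_inf_dist]), so
    the value functions differ by at most [C * W1 pi \d_f] on the whole of
    [[0, T] x R^n], which is the uniform convergence.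

    The Lipschitz estimate is Gronwall's inequality for the difference [w] of
    two absolutely continuous trajectories ([ac_gronwall]).  The derivative of
    [w] is only known almost everywhere.  Instead of recovering [w] as the
    integral of its derivative, the proof covers the exceptional null set by an
    open set [O] of small measure.  By absolute continuity the variation of [w]
    inside [O] is small ([small_variation]); outside [O] the differential
    inequality holds pointwise.  Real induction along the time interval combines
    the two kinds of points.

    For the averaging step, a coupling with a Dirac mass is concentrated on the
    pairs whose second component is [f], so that the transport cost of any
    coupling dominates the [pi]-integral of every nonnegative measurable function
    that lies below the distance to [f] ([W1_dirac_ge]).  It is applied to a multiple of
    [|cost g - cost f|], whose measurability is part of the integrability of
    the cost. *)

(** * The Euclidean norm and derivatives *)

Lemma enormZ {R : realType} {n : nat} (a : R) (x : 'rV[R]_n) :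
  enorm (a *: x) = `|a| * enorm x.
Proof.
rewrite /enorm -sqrtr_sqr -sqrtrM ?sqr_ge0// mulr_sumr.
by congr Num.sqrt; apply: eq_bigr => i _; rewrite mxE exprMn.
Qed.

Lemma enorm_row_mx0 {R : realType} {n m : nat} (x : 'rV[R]_n) :
  enorm (row_mx x (0 : 'rV[R]_m)) = enorm x.
Proof.
rewrite /enorm big_split_ord/= [X in _ + X]big1 ?addr0.
  by congr Num.sqrt; apply: eq_bigr => i _; rewrite row_mxEl.
by move=> i _; rewrite row_mxEr mxE expr0n.
Qed.

Lemma enorm_eq0 {R : realType} {n : nat} (x : 'rV[R]_n) : enorm x = 0 -> x = 0.
Proof.
move=> x0; apply/rowP => i; rewrite mxE.
have /eqP := sqr_enorm x.
rewrite x0 expr0n eq_sym psumr_eq0 => [/allP/(_ i)|j _]; last exact: sqr_ge0.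
by rewrite mem_index_enum => /(_ isT); rewrite sqrf_eq0 => /eqP.
Qed.

Lemma enorm_continuous {R : realType} {n : nat} :
  continuous (@enorm R n).
Proof.
move=> x; rewrite /enorm.
apply: (@continuous_comp _ _ _ (fun y : 'rV[R]_n => \sum_(i < n) y 0 i ^+ 2)
  Num.sqrt); last exact: sqrt_continuous.
move: x; apply: continuous_big => [|i _ x]; first exact: add_continuous.
apply: (continuous_comp (g := fun z : R => z ^+ 2)).
  exact: coord_continuous.
exact: exprn_continuous.
Qed.

Lemma is_derive_enorm_increment {R : realType} {n : nat} (w : R -> 'rV[R]_n)
    (c : R) (dw : 'rV[R]_n) (eta : R) : is_derive c 1 w dw -> 0 < eta ->
  exists2 d : R, 0 < d & forall t, c < t < c + d ->
    enorm (w t - w c) <= (enorm dw + eta) * (t - c).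
Proof.
move=> [dr dE] eta0.
have /= cv : enorm (h^-1 *: (w (h *: 1 + c) - w c)) @[h --> 0^'] --> enorm dw.
  apply: cvg_comp; last exact: enorm_continuous.
  by rewrite -dE; exact: dr.
have : \forall h \near 0^', enorm (h^-1 *: (w (h *: 1 + c) - w c)) < enorm dw + eta.
  by apply: cvgr_lt cv _ _; rewrite ltrDl.
move=> /nbhs_ballP[d/= d0 H]; exists d => // t /andP[ct tcd].
have tc0 : 0 < t - c by rewrite subr_gt0.
have := H (t - c); rewrite /ball/= sub0r normrN gtr0_norm// ltrBlDl.
move=> /(_ tcd); rewrite gt_eqF// => /(_ isT) /ltW.
rewrite [(t - c) *: 1]mulr1 subrK enormZ.
by rewrite gtr0_norm ?invr_gt0// ler_pdivrMl// mulrC.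
Qed.

(** * Null sets and real induction *)

(** Outer regularity at a null set: the outer Lebesgue measure can be computed
    with countable covers by open intervals. *)
Lemma ae_open_exception {R : realType} (P : R -> Prop) (d : R) :
  {ae @completed_lebesgue_measure R, forall t, P t} -> 0 < d ->
  exists O : set R, [/\ open O, (forall t, ~ P t -> O t) &
    (@lebesgue_measure R O < d%:E)%E].
Proof.
move=> [N [mN N0 PN]] d0.
have NE : ((@wlength R idfun)^* N)%mu = 0%E by exact: N0.
have fN : ((@wlength R idfun)^* N)%mu \is a fin_num by rewrite NE.
have := lb_ereal_inf_adherent d0.
move=> /(_ [set (\sum_(k <oo) (@wlength R idfun) (F k))%E | F in open_itv_cover N]).
rewrite -outer_measure_open_itv_cover => /(_ fN)[_ [F [Fo NF] <-]].
rewrite NE add0e => Fd.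
have oF k : open (F k) by have [ab ->] := Fo k; exact: interval_open.
exists (\bigcup_k F k); split.
- exact: bigcup_open.
- by move=> t Pt; apply: NF; apply: PN.
- apply: le_lt_trans Fd.
  apply: le_trans (outer_measure_sigma_subadditive _ _) _.
  apply: lee_nneseries => // k _.
  have [ab ->] := Fo k.
  change (@lebesgue_measure R `]ab.1, ab.2[ <= wlength idfun `]ab.1, ab.2[)%E.
  by rewrite lebesgue_measure_itv wlength_itv.
Qed.

(** Induction along a compact interval; the supremum of the set of points where
    [P] holds can only be [b]. *)
Lemma real_induction {R : realType} (a b : R) (P : R -> Prop) :
  a <= b -> P a ->
  (forall c, a <= c < b -> P c -> exists2 c', c < c' <= b & P c') ->
  (forall c, a <= c <= b ->
    (forall d, 0 < d -> exists2 t, c - d < t <= c & a <= t /\ P t) -> P c) ->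
  P b.
Proof.
move=> ab Pa Pr Pl; pose S := [set t | a <= t <= b /\ P t].
have Sa : S a by rewrite /S/= lexx ab.
have hS : has_sup S.
  by split; [exists a | exists b => t [/andP[_ tb] _]].
have Sle t : S t -> t <= sup S by move=> St; exact: ub_le_sup hS.2 _ St.
have sb : a <= sup S <= b.
  rewrite Sle//=; apply: ge_sup; first by exists a.
  by move=> t [/andP[]].
have Ps : P (sup S).
  apply: Pl => // d d0; have [t St td] := sup_adherent d0 hS.
  by exists t; [rewrite td Sle | case: St => /andP[]].
have /andP[as_] := sb; rewrite le_eqVlt => /predU1P[<-//|slb].
have [|c' /andP[sc' c'b] Pc'] := Pr (sup S) _ Ps; first by rewrite as_.
have : c' <= sup S by apply: Sle; split => //; rewrite c'b (le_trans as_ (ltW _)).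
by rewrite leNgt sc'.
Qed.

(** * Absolutely continuous functions and Gronwall's inequality *)

(** A finite family of disjoint subintervals of [[a, t]], as in the definition of
    absolute continuity, whose interiors lie in [O]. *)
Definition intervals_in {R : realType} (O : set R) (a t : R) (k : nat)
    (l r : 'I_k -> R) : Prop :=
  [/\ forall i, [/\ a <= l i, l i <= r i & r i <= t],
      trivIset setT (fun i => `]l i, r i[%classic) &
      forall i, `]l i, r i[%classic `<=` O].

Lemma intervals_in_length {R : realType} (O : set R) (a t : R) (k : nat)
    (l r : 'I_k -> R) : open O -> intervals_in O a t k l r ->
  ((\sum_i (r i - l i))%:E <= @lebesgue_measure R O)%E.
Proof.
move=> oO [lr tr sub].
have -> : ((\sum_i (r i - l i))%:E =
    \sum_(i < k) @lebesgue_measure R `]l i, r i[%classic)%E.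
  rewrite -sumEFin; apply: eq_bigr => i _.
  rewrite lebesgue_measure_itv/= lte_fin EFinB; case: ltP => // rl.
  have [_ lr' _] := lr i; have -> : l i = r i by apply/eqP; rewrite eq_le lr'.
  by rewrite subee.
rewrite -measure_bigsetU_ord//.
apply: (@le_measure _ _ _ (@lebesgue_measure R)); rewrite ?inE.
- apply: bigsetU_measurable => i _. exact: measurable_itv.
- exact: open_measurable.
- by apply: (big_ind (fun A => A `<=` O)) => // A B AO BO; rewrite subUset.
Qed.

Lemma intervals_inW {R : realType} (O : set R) (a t t' : R) (k : nat)
    (l r : 'I_k -> R) : t <= t' ->
  intervals_in O a t k l r -> intervals_in O a t' k l r.
Proof.
move=> tt' [lr tr sub]; split=> // i.
by have [al ll rt] := lr i; split=> //; exact: le_trans tt'.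
Qed.

(** The interval [[t, t']] is put first, at index [ord0]; it is disjoint from the
    other intervals, which end at [t] or earlier. *)
Lemma intervals_in_extend {R : realType} (O : set R) (a t t' : R) (k : nat)
    (l r : 'I_k -> R) : a <= t <= t' -> `]t, t'[%classic `<=` O ->
  intervals_in O a t k l r ->
  intervals_in O a t' k.+1 (fun i => oapp l t (unlift ord0 i))
                           (fun i => oapp r t' (unlift ord0 i)).
Proof.
move=> /andP[at_ tt'] tO [lr tr sub]; split.
- move=> i; case: unliftP => [j|] _ /=; last by split.
  by have [al ll rt] := lr j; split=> //; exact: le_trans tt'.
- have disj j x : `]l j, r j[%classic x -> `]t, t'[%classic x -> False.
    rewrite /= !in_itv/= => /andP[_ xr] /andP[tx _]; have [_ _ rt] := lr j.
    by move: (lt_trans (lt_le_trans xr rt) tx); rewrite ltxx.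
  move=> i i' _ _; case: unliftP => [j|] ->; case: unliftP => [j'|] -> //=.
  + by move=> /(tr j j' Logic.I Logic.I) ->.
  + by move=> [x [/disj/[apply]]].
  + by move=> [x [/[swap] /disj/[apply]]].
- by move=> i; case: unliftP => [j|] _ //=; exact: sub.
Qed.

(** [V t] is the variation of [w] inside [O] up to time [t], the supremum of the
    sums of increments over the families [intervals_in O a t].  Such a family has
    total length at most the measure of [O], so absolute continuity bounds its sum
    by [e]; the last property holds because an interval inside [O] can be
    added to a family that ends before it. *)
Lemma small_variation {R : realType} {n : nat} (a b : R) (w : R -> 'rV[R]_n)
    (e : R) : absolutely_continuous a b w -> 0 < e ->
  exists2 d : R, 0 < d & forall O : set R, open O ->
    (@lebesgue_measure R O < d%:E)%E ->
  exists V : R -> R,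
    [/\ forall t, a <= t <= b -> 0 <= V t <= e,
        forall t t', a <= t -> t <= t' -> t' <= b -> V t <= V t' &
        forall t t', a <= t -> t <= t' -> t' <= b -> `]t, t'[%classic `<=` O ->
          V t + enorm (w t' - w t) <= V t'].
Proof.
move=> acw e0; have [d d0 dP] := acw e e0; exists d => // O oO Od.
pose S t := [set v | exists k (l r : 'I_k -> R),
  intervals_in O a t k l r /\ v = \sum_i enorm (w (r i) - w (l i))].
have Se t v : t <= b -> S t v -> v <= e.
  move=> tb [k [l [r [lr ->]]]]; apply/ltW/dP.
  - by have [] := intervals_inW _ _ _ _ _ _ _ tb lr.
  - by have [] := lr.
  - by rewrite -lte_fin; apply: le_lt_trans Od; exact: intervals_in_length lr.
have S0 t : S t 0.
  exists 0, (fun=> 0), (fun=> 0); split; last by rewrite big_ord0.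
  by split=> [[]//|[]//|[]//].
have hS t : t <= b -> has_sup (S t).
  by move=> tb; split; [exists 0 | exists e => v; exact: Se].
exists (fun t => sup (S t)); split.
- move=> t /andP[_ tb]; apply/andP; split.
    by apply: ub_le_sup => //; exact: (hS _ tb).2.
  by apply: ge_sup; [exists 0 | move=> v; exact: Se].
- move=> t t' at_ tt' t'b; apply: le_sup; last exact: hS.
    move=> v [k [l [r [lr ->]]]]; exists (\sum_i enorm (w (r i) - w (l i))); split=> //.
    by exists k, l, r; split=> //; exact: intervals_inW lr.
  by exists 0.
- move=> t t' at_ tt' t'b tO; rewrite -lerBrDr; apply: ge_sup; first by exists 0.
  move=> v [k [l [r [lr ->]]]]; rewrite lerBrDr.
  apply: ub_le_sup; first exact: (hS _ t'b).2.
  have lr' := intervals_in_extend _ _ _ t' _ _ _ _ tO lr.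
  exists k.+1, (fun i => oapp l t (unlift ord0 i)),
    (fun i => oapp r t' (unlift ord0 i)); split.
    by apply: lr'; rewrite at_.
  rewrite big_ord_recl unlift_none /= addrC; congr (_ + _).
  by apply: eq_bigr => i _; rewrite liftK.
Qed.

(** With [V] the variation of [w] inside an open set [O] of small measure that
    contains the times where the differential inequality fails, the bound
    [enorm (w t) <= expR (L (t - a)) * ((K + e) (t - a) + V t)] propagates by real
    induction: across points of [O] the increment of [w] is absorbed by that of
    [V], across the other points it is controlled by the derivative, and left
    limits are harmless because [w] is continuous and the bound nondecreasing.
    Since [V <= e], letting [e] tend to 0 gives the claim. *)
Lemma ac_gronwall {R : realType} {n : nat} (a b : R) (w : R -> 'rV[R]_n)
    (K L : R) : 0 <= K -> 0 <= L -> a <= b ->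
  absolutely_continuous a b w -> w a = 0 ->
  {ae @completed_lebesgue_measure R, forall t, t \in `[a, b] ->
    exists2 dw, is_derive t 1 w dw & enorm dw <= K + L * enorm (w t)} ->
  enorm (w b) <= expR (L * (b - a)) * (K * (b - a)).
Proof.
move=> K0 L0 ab acw wa aew.
suff H e : 0 < e -> enorm (w b) <= expR (L * (b - a)) * ((K + e) * (b - a) + e).
  apply/ler_addgt0Pr => e e0.
  (* [H] at [e / D] exceeds the claimed bound by exactly [e]. *)
  pose D := expR (L * (b - a)) * (b - a + 1).
  have D0 : 0 < D by rewrite mulr_gt0 ?expR_gt0// ltr_wpDl// subr_ge0.
  have := H (e / D) (divr_gt0 e0 D0); congr (_ <= _).
  rewrite -[X in _ = _ + X](mulfVK (lt0r_neq0 D0)) /D; ring.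
move=> e0.
have [d d0 dV] := small_variation _ _ _ e acw e0.
have [ O [oO PO Od]] := ae_open_exception _ _ aew d0.
have [V [V0e Vnd VO]] := dV O oO Od.
pose E t := expR (L * (t - a)).
have EM t t' : E t' = expR (L * (t' - t)) * E t.
  by rewrite /E -expRD; congr expR; ring.
have Egt0 t : 0 < E t by exact: expR_gt0.
have E1 t : a <= t -> 1 <= E t.
  by move=> at_; rewrite -expR0 ler_expR mulr_ge0// subr_ge0.
have End t t' : t <= t' -> E t <= E t'.
  by move=> tt'; rewrite ler_expR ler_wpM2l// lerB.
pose B t := (K + e) * (t - a) + V t.
have Bnd t t' : a <= t -> t <= t' -> t' <= b -> B t <= B t'.
  move=> at_ tt' t'b; rewrite lerD ?Vnd//.
  by rewrite ler_wpM2l ?lerB// addr_ge0// ltW.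
have Ke0 : 0 <= K + e by rewrite addr_ge0// ltW.
have B0 t : a <= t <= b -> 0 <= B t.
  move=> atb; rewrite addr_ge0//; last by have /andP[] := V0e t atb.
  by rewrite mulr_ge0// subr_ge0; case/andP: atb.
suff : enorm (w b) <= E b * B b.
  move=> /le_trans; apply; rewrite ler_wpM2l ?(ltW (Egt0 _))//.
  by rewrite lerD2l; have /andP[] : 0 <= V b <= e by apply: V0e; rewrite ab lexx.
apply: (@real_induction _ a b (fun t => enorm (w t) <= E t * B t)) => //.
- by rewrite wa enorm0 mulr_ge0 ?(ltW (Egt0 _))// B0// lexx.
- move=> c /andP[ac cb] IH.
  have [Oc|nOc] := pselect (O c).
    (* Inside the open set: move right within [O]; [V] pays for the increment. *)
    have [r/= r0 rO] := (nbhs_ballP _ _).1 (open_nbhs_nbhs (conj oO Oc)).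
    pose c' := Num.min b (c + r / 2).
    have cc' : c < c' by rewrite lt_min cb ltrDl divr_gt0.
    have c'b : c' <= b by rewrite ge_min lexx.
    exists c'; first by rewrite cc'.
    have cO : `]c, c'[%classic `<=` O.
      move=> x /=; rewrite in_itv/= => /andP[cx xc']; apply: rO.
      rewrite /ball/= distrC gtr0_norm ?subr_gt0//.
      have : c' <= c + r / 2 by rewrite ge_min lexx orbT.
      by lra.
    have Vc' := VO c c' ac (ltW cc') c'b cO.
    rewrite -[w c'](subrK (w c)) addrC; apply: le_trans (enormD _ _) _.
    apply: (@le_trans _ _ (E c' * (B c + enorm (w c' - w c)))); last first.
      rewrite ler_wpM2l ?(ltW (Egt0 _))// /B -addrA lerD//.
      by rewrite ler_wpM2l// lerB// ltW.
    rewrite mulrDr lerD//.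
      by apply: le_trans IH _; rewrite ler_wpM2r ?End ?(ltW cc')// B0// ac ltW.
    by rewrite ler_peMl ?enorm_ge0// E1// (le_trans ac)// ltW.
  (* Outside [O] the derivative exists and satisfies the inequality. *)
  have [dw wdw dwK] : exists2 dw, is_derive c 1 w dw &
      enorm dw <= K + L * enorm (w c).
    apply: contrapT => H; apply: nOc; apply: PO => H'; apply/H/H'.
    by rewrite in_itv/= ac ltW.
  have [r r0 rP] := is_derive_enorm_increment _ _ _ e wdw e0.
  pose c' := Num.min b (c + r / 2).
  have cc' : c < c' by rewrite lt_min cb ltrDl divr_gt0.
  have c'b : c' <= b by rewrite ge_min lexx.
  exists c'; first by rewrite cc'.
  have c'r : c' < c + r.
    have : c' <= c + r / 2 by rewrite ge_min lexx orbT.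
    by lra.
  have incr := rP c' _; rewrite cc' c'r in incr; have {}incr := incr isT.
  rewrite -[w c'](subrK (w c)) addrC; apply: le_trans (enormD _ _) _.
  have cc'0 : 0 <= c' - c by rewrite subr_ge0 ltW.
  apply: (@le_trans _ _ ((1 + L * (c' - c)) * enorm (w c) + (K + e) * (c' - c))).
    have : enorm (w c' - w c) <= (K + L * enorm (w c) + e) * (c' - c).
      by apply: le_trans incr _; rewrite ler_wpM2r// lerD2r.
    set A := enorm (w c); set A' := enorm _; move=> AA'.
    have -> : (1 + L * (c' - c)) * A + (K + e) * (c' - c) =
      A + (K + L * A + e) * (c' - c) by ring.
    by rewrite lerD2l.
  apply: (@le_trans _ _ (E c' * B c + E c' * ((K + e) * (c' - c)))).
    apply: lerD.
      rewrite (EM c c') -mulrA; apply: ler_pM => //.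
      - by rewrite addr_ge0// mulr_ge0.
      - exact: enorm_ge0.
      - exact: expR_ge1Dx.
    by rewrite ler_peMl ?mulr_ge0// E1// (le_trans ac)// ltW.
  rewrite -mulrDr ler_wpM2l ?(ltW (Egt0 _))//.
  have Vcc' := Vnd c c' ac (ltW cc') c'b; rewrite /B.
  have -> : (K + e) * (c - a) + V c + (K + e) * (c' - c) =
    (K + e) * (c' - a) + V c by ring.
  by rewrite lerD2l.
(* Left limits: a single short interval in the definition of absolute
   continuity gives the continuity of [w]. *)
- move=> c /andP[ac cb] Hc; apply/ler_addgt0Pr => eta eta0.
  have [del del0 delP] := acw eta eta0.
  have [t /andP[cdt tc] [at_ IH]] := Hc del del0.
  rewrite -[w c](subrK (w t)) addrC; apply: le_trans (enormD _ _) _.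
  apply: lerD; last first.
    have := delP 1%N (fun=> t) (fun=> c); rewrite !big_ord1 => H'.
    apply/ltW/H'; [by [] | by move=> i j _ _ _; rewrite (ord1 i) (ord1 j) | lra].
  apply: le_trans IH _.
  by rewrite ler_pM ?(ltW (Egt0 _))// ?B0 ?at_ ?(le_trans tc)// ?End ?Bnd.
Qed.

(** * Stability of trajectories and costs in the dynamics *)

Lemma absolutely_continuousB {R : realType} {n : nat} (a b : R)
    (x y : R -> 'rV[R]_n) :
  absolutely_continuous a b x -> absolutely_continuous a b y ->
  absolutely_continuous a b (x - y).
Proof.
move=> acx acy e e0; have e20 : 0 < e / 2 by rewrite divr_gt0.
have [d1 d10 d1P] := acx _ e20; have [d2 d20 d2P] := acy _ e20.
exists (Num.min d1 d2); first by rewrite lt_min d10.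
move=> k l r lr tr; rewrite lt_min => /andP[lrd1 lrd2].
have := ltrD (d1P k l r lr tr lrd1) (d2P k l r lr tr lrd2).
rewrite -splitr; apply: le_lt_trans; rewrite -big_split/=.
apply: ler_sum => i _; rewrite !fctE -(enormN (y (r i) - _)).
apply: le_trans (enormD _ _).
by rewrite (opprD (x (l i))) addrACA -opprD.
Qed.

Lemma absolutely_continuousS {R : realType} {n : nat} (a b c : R)
    (x : R -> 'rV[R]_n) : c <= b ->
  absolutely_continuous a b x -> absolutely_continuous a c x.
Proof.
move=> cb acx e /acx[d d0 dP]; exists d => // k l r lr tr.
apply: dP => // i; have [al ll rc] := lr i; split=> //; exact: le_trans cb.
Qed.

Lemma trajectory_is_solution {R : realType} {n m : nat} {U : set 'rV[R]_m}
    (T : R) (g : dynamics n U) (s : R) (x0 : 'rV[R]_n) (u : R -> U) :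
  unique_solution T g s x0 u -> is_solution T g s x0 u (trajectory T g s x0 u).
Proof. by move=> [x xsol _]; apply: xgetPex; exists x. Qed.

(** The difference of the velocities splits as
    [(g (x, u) - f (x, u)) + (f (x, u) - f (y, u))]: the first term is at most [K],
    the second at most [L] times the distance of the trajectories. *)
Lemma solution_dist {R : realType} {n m : nat} {U : set 'rV[R]_m}
    (T : R) (g f : dynamics n U) (s : R) (x0 : 'rV[R]_n) (u : R -> U)
    (x y : R -> 'rV[R]_n) (K L : R) : 0 <= K -> 0 <= L ->
  (forall z, enorm (g z - f z) <= K) ->
  (forall x1 x2 v, enorm (f (x1, v) - f (x2, v)) <= L * enorm (x1 - x2)) ->
  is_solution T g s x0 u x -> is_solution T f s x0 u y ->
  forall t, t \in `[s, T] ->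
    enorm (x t - y t) <= expR (L * (t - s)) * (K * (t - s)).
Proof.
move=> K0 L0 gf fL [acx xs dx] [acy ys dy] t; rewrite in_itv/= => /andP[st tT].
apply: (@ac_gronwall _ _ s t (x - y)) => //.
- exact/(absolutely_continuousS _ _ _ _ tT)/absolutely_continuousB.
- by rewrite !fctE xs ys subrr.
- apply: (@filterS2 _ _ (ae_filter_ringOfSetsType _) _ _ _ _ dx dy) => r dxr dyr rst.
  have rsT : r \in `[s, T].
    by move: rst; rewrite !in_itv/= => /andP[-> /le_trans]; apply.
  have {}dxr := dxr rsT; have {}dyr := dyr rsT.
  exists (g (x r, u r) - f (y r, u r)); first exact: is_deriveB.
  rewrite -(subrK (f (x r, u r)) (g _)) -addrA.
  by apply: le_trans (enormD _ _) _; apply: lerD.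
Qed.

(** The completed Lebesgue measure and the Lebesgue measure on Borel sets are
    restrictions of the same outer measure. *)
Lemma completed_lebesgue_measure_itvcc {R : realType} (a b : R) : a <= b ->
  completed_lebesgue_measure `[a, b]%classic = (b - a)%:E.
Proof.
move=> ab; transitivity (@lebesgue_measure R `[a, b]%classic); first by [].
rewrite lebesgue_measure_itv/= lte_fin; case: ltP => // ba.
by rewrite (@le_anti _ _ b a) ?subrr// ab ba.
Qed.

Lemma measurable_completed_itv {R : realType} (i : interval R) :
  @measurable _ (lebesgue_measurableType R) [set` i].
Proof. by apply: sub_caratheodory; exact: (@measurable_itv R i). Qed.

(** The trajectories stay within [expR (L * T) * T * K] of each other, which the
    terminal cost multiplies by [Lh] and the running cost by [Lell * T]. *)
Lemma cost_dist {R : realType} {n m : nat} {U : set 'rV[R]_m}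
    (T : R) (g f : dynamics n U) (ell : 'rV[R]_n * U -> R)
    (h : 'rV[R]_n -> R) (s : R) (x0 : 'rV[R]_n) (u : R -> U)
    (K L Lell Lh : R) : 0 <= K -> 0 <= L -> 0 <= Lell -> 0 <= Lh ->
  s \in `[0, T] ->
  (forall z, enorm (g z - f z) <= K) ->
  (forall x1 x2 v, enorm (f (x1, v) - f (x2, v)) <= L * enorm (x1 - x2)) ->
  (forall x1 x2 v, `|ell (x1, v) - ell (x2, v)| <= Lell * enorm (x1 - x2)) ->
  (forall x1 x2, `|h x1 - h x2| <= Lh * enorm (x1 - x2)) ->
  unique_solution T g s x0 u -> unique_solution T f s x0 u ->
  (@completed_lebesgue_measure R).-integrable `[s, T]%classic
    (fun t => (running_cost T ell g s x0 u t)%:E) ->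
  (@completed_lebesgue_measure R).-integrable `[s, T]%classic
    (fun t => (running_cost T ell f s x0 u t)%:E) ->
  `|cost T ell h g s x0 u - cost T ell h f s x0 u| <=
    (Lell * T + Lh) * (expR (L * T) * T) * K.
Proof.
move=> K0 L0 Lell0 Lh0 sT gf fL ellL hL gsol fsol gint fint.
have /andP[s0 sT'] : 0 <= s <= T by rewrite in_itv in sT.
pose M := expR (L * T) * T * K.
have M0 : 0 <= M by rewrite !mulr_ge0 ?expR_ge0// (le_trans s0).
have dist t : t \in `[s, T] ->
    enorm (trajectory T g s x0 u t - trajectory T f s x0 u t) <= M.
  move=> tsT; have := solution_dist _ _ _ _ _ _ _ _ _ _ K0 L0 gf fL
    (trajectory_is_solution _ _ _ _ _ gsol) (trajectory_is_solution _ _ _ _ _ fsol) _ tsT.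
  move=> /le_trans; apply; rewrite /M -mulrA.
  have /andP[st tT] : s <= t <= T by rewrite in_itv in tsT.
  have tsT0 : t - s <= T by lra.
  rewrite ler_pM ?expR_ge0 ?mulr_ge0 ?subr_ge0//.
    by rewrite ler_expR ler_wpM2l.
  by rewrite mulrC ler_wpM2r.
have mI : @measurable _ (lebesgue_measurableType R) `[s, T]%classic.
  exact: measurable_completed_itv.
rewrite /cost opprD addrACA -RintegralB//.
apply: le_trans (ler_normD _ _) _.
have -> : (Lell * T + Lh) * (expR (L * T) * T) * K = Lell * M * T + Lh * M.
  by rewrite /M; ring.
apply: lerD; last first.
  apply: le_trans (hL _ _) _; rewrite ler_wpM2l// dist//.
  by rewrite in_itv/= sT' lexx.
have Bint : (@completed_lebesgue_measure R).-integrable `[s, T]%classic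
    (EFin \o (fun t => running_cost T ell g s x0 u t - running_cost T ell f s x0 u t)).
  rewrite (_ : EFin \o _ = (fun t => (running_cost T ell g s x0 u t)%:E -
    (running_cost T ell f s x0 u t)%:E)%E); first exact: integrableB.
  by apply/funext => t /=; rewrite EFinB.
have := le_normr_Rintegral mI Bint; move=> /le_trans; apply.
apply: (@le_trans _ _ (\int[completed_lebesgue_measure]_(t in `[s, T]%classic) (Lell * M))).
  apply: le_Rintegral => //.
  - exact: integrable_norm Bint.
  - apply: measurable_bounded_integrable => //.
      by apply: le_lt_trans (ltry (T - s)); rewrite -completed_lebesgue_measure_itvcc.
    exists (Lell * M); split; [exact: num_real|move=> N MN t _ /=].
    by rewrite ger0_norm ?(ltW MN)//; exact: mulr_ge0.
  - move=> t tsT; apply: le_trans (ellL _ _ _) _.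
    by rewrite ler_wpM2l// dist.
rewrite Rintegral_cst//.
have -> : fine (completed_lebesgue_measure `[s, T]%classic) = T - s.
  by rewrite completed_lebesgue_measure_itvcc.
by rewrite ler_wpM2l ?mulr_ge0//; lra.
Qed.

(** * The Wasserstein distance to a Dirac mass *)

(** The integral of a nonnegative function is a supremum over the simple functions
    below it, hence monotone on arbitrary functions.  It is applied with [f2] the
    transport cost, a supremum over an uncountable set whose measurability for the
    product sigma-algebra is a separate matter. *)
Lemma ge0_le_integral_nonmeasurable {d} {T : measurableType d} {R : realType}
    (mu : {measure set T -> \bar R}) (f1 f2 : T -> \bar R) :
  (forall x, 0 <= f1 x)%E -> (forall x, f1 x <= f2 x)%E ->
  (\int[mu]_x f1 x <= \int[mu]_x f2 x)%E.
Proof.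
move=> f10 f12; have f20 x : (0 <= f2 x)%E by exact: le_trans (f12 x).
rewrite !ge0_integralTE//; apply: ge_ereal_sup => _ [h/= hf <-].
by apply: ereal_sup_ubound; exists h => //= x; exact: le_trans (f12 x).
Qed.

(** The singleton is closed, since distinct dynamics are at positive distance. *)
Lemma measurable_borel_base {R : realType} {n m : nat} {U : set 'rV[R]_m}
    {X : set (dynamics n U)} (f : X) :
  @measurable _ (borel f) [set f].
Proof.
rewrite -[X in measurable X]setCK; apply: measurableC.
apply: sub_sigma_algebra.
have -> : ~` [set f] = set_val @^-1` [set g : dynamics n U | g != set_val f].
  by apply/seteqP; split=> g /=;
    [move=> gf; apply/eqP => /val_inj | move=> /eqP gf gf'; apply: gf; rewrite gf'].
have oD : open [set g : dynamics n U | g != set_val f].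
  rewrite openE => g /= /eqP gf.
  have [z gfz] : exists z, g z <> set_val f z.
    by apply/existsNP => H; apply: gf; apply/funext.
  pose r := enorm (g z - set_val f z).
  have r0 : 0 < r.
    rewrite lt_neqAle enorm_ge0 andbT eq_sym; apply/eqP => /enorm_eq0 /eqP.
    by rewrite subr_eq0 => /eqP.
  apply/nbhs_ballP; exists r => // g' /= gg'; apply/eqP => g'f; move: gg'.
  rewrite g'f /ball/= /dynamics_ball/= ltNge => /negP; apply.
  by apply: ereal_sup_ubound; exists z.
by apply: (continuousP _).1 oD; exact: initial_continuous.
Qed.

(** Under any coupling [gamma] the second component is [f] almost surely; there,
    [psi] of the first component is below the transport cost, and the integral of
    [psi] of the first component is that of [psi] under [pi]. *)
Lemma W1_dirac_ge {R : realType} {n m : nat} {U : set 'rV[R]_m}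
    {X : set (dynamics n U)} {f : X} (pi : probability (borel f) R)
    (psi : borel f -> \bar R) :
  measurable_fun [set: borel f] psi -> (forall g, 0 <= psi g)%E ->
  (forall g : X, psi g <= sup_dist (set_val g) (set_val f))%E ->
  (forall g1 g2 : X, 0 <= sup_dist (set_val g1) (set_val g2))%E ->
  (\int[pi]_g psi g <= W1 pi \d_(f : borel f))%E.
Proof.
move=> mpsi psi0 psile sd0; apply: le_ereal_inf_tmp => _ [gamma [g1 g2] <-].
pose A := (snd : borel f * borel f -> borel f) @^-1` [set f].
have mf := measurable_borel_base f.
have mA : measurable A.
  by rewrite -[A]setTI; apply: measurable_snd.
have gA : gamma (~` A) = 0%E.
  rewrite probability_setC// /A (g2 _ mf).
  rewrite -[X in (1 - X)%E]/((\1_[set f] f)%:E)%E.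
  by rewrite indicE mem_set//= subee.
have mpsi1 : measurable_fun setT (fun p : borel f * borel f => psi p.1).
  by apply: measurableT_comp.
have -> : (\int[pi]_g psi g = \int[gamma]_p psi p.1)%E.
  rewrite -[RHS](@ge0_integral_pushforward _ _ _ _ _ _ measurable_fst gamma setT psi)//.
  by apply: eq_measure_integral => B mB _; exact/esym/g1.
rewrite (ge0_negligible_integral _ _ _ _ gA)//; last exact: measurableC.
rewrite setDE setCK setTI integral_mkcond.
apply: ge0_le_integral_nonmeasurable => -[h1 h2]; rewrite patchE; case: ifPn => //=.
by rewrite inE /A/= => ->.
Qed.

(** [W1_dirac_ge] applied to [|F - F f| / C], measurable because [F] is integrable. *)
Lemma mean_dist_le_W1 {R : realType} {n m : nat} {U : set 'rV[R]_m}
    {X : set (dynamics n U)} {f : X} (pi : probability (borel f) R)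
    (F : borel f -> R) (C : R) : 0 < C ->
  pi.-integrable [set: borel f] (EFin \o F) ->
  (forall g : X, (`|F g - F f|%:E <= C%:E * sup_dist (set_val g) (set_val f))%E) ->
  (forall g1 g2 : X, 0 <= sup_dist (set_val g1) (set_val g2))%E ->
  (`|\int[pi]_g F g - F f|%:E <= C%:E * W1 pi \d_(f : borel f))%E.
Proof.
move=> C0 intF FC sd0.
have intc : pi.-integrable [set: borel f] (EFin \o cst (F f)).
  exact: finite_measure_integrable_cst.
have intB : pi.-integrable [set: borel f] (EFin \o (fun g => F g - F f)).
  rewrite (_ : EFin \o _ = ((EFin \o F) \- (EFin \o cst (F f)))%E).
    exact: integrableB.
  by apply/funext.
have -> : \int[pi]_g F g - F f = \int[pi]_g (F g - F f).
  rewrite RintegralB//; congr (_ - _).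
  by rewrite Rintegral_cst// [X in fine X](@probability_setT _ _ _ pi) mulr1.
rewrite EFin_normr_Rintegral//.
apply: le_trans (le_abse_integral _ measurableT (measurable_int _ intB)) _.
pose psi (g : borel f) := (C^-1%:E * `|(F g - F f)%:E|)%E.
have mabs : measurable_fun [set: borel f] (fun g => `|(F g - F f)%:E|)%E.
  by apply: measurableT_comp => //; exact: measurable_int intB.
have -> : (\int[pi]_g `|(EFin \o (fun g => F g - F f)%R) g| =
    C%:E * \int[pi]_g psi g)%E.
  rewrite /psi ge0_integralZl_EFin//; last by rewrite invr_ge0 ltW.
  by rewrite muleA -EFinM divff ?gt_eqF// mul1e.
rewrite lee_pmul2l//; apply: W1_dirac_ge => //.
- exact: measurable_funeM.
- by move=> g; rewrite mule_ge0// lee_fin invr_ge0 ltW.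
- by move=> g; rewrite /psi lee_pdivrMl//; exact: FC.
Qed.

(** * Convergence of the value functions *)

Lemma ereal_inf_dist {R : realType} {I : Type} (A : set I) (F G : I -> R)
    (d : R) : (forall i, A i -> `|F i - G i| <= d) ->
  ereal_inf [set (F i)%:E | i in A] \is a fin_num ->
  ereal_inf [set (G i)%:E | i in A] \is a fin_num ->
  `|fine (ereal_inf [set (F i)%:E | i in A]) -
    fine (ereal_inf [set (G i)%:E | i in A])| <= d.
Proof.
have le (F' G' : I -> R) : (forall i, A i -> `|F' i - G' i| <= d) ->
  ereal_inf [set (F' i)%:E | i in A] \is a fin_num ->
  ereal_inf [set (G' i)%:E | i in A] \is a fin_num ->
  fine (ereal_inf [set (F' i)%:E | i in A]) <=
    fine (ereal_inf [set (G' i)%:E | i in A]) + d.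
  move=> FG fF fG; rewrite -lee_fin EFinD !fineK// -leeBlDr//.
  apply: le_ereal_inf_tmp => _ [i Ai <-]; rewrite leeBlDr//.
  apply: (@le_trans _ _ (F' i)%:E); first by apply: ereal_inf_lbound; exists i.
  rewrite -EFinD lee_fin; have := FG i Ai; rewrite ler_norml => /andP[_].
  by rewrite lerBlDl.
move=> FG fF fG; rewrite ler_norml; apply/andP; split.
  rewrite lerNl opprB lerBlDl; apply: le => // i Ai.
  by rewrite distrC FG.
by rewrite lerBlDl; exact: le.
Qed.

Theorem mainTheorem2 (R : realType) (n m : nat) (T : R) (hT : 0 < T)
  (U : set 'rV[R]_m) (U_closed : closed U) (U_nonempty : U !=set0)
  (X : set (dynamics n U))
  (X_continuous : forall g, X g -> continuous (g : 'rV[R]_n * U -> 'rV[R]_n))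
  (X_finite : forall g1 g2, X g1 -> X g2 -> (sup_dist g1 g2 < +oo)%E)
  (X_compact : compact X)
  (f : X)
  (f_lipschitz : exists L : R, forall (x y : 'rV[R]_n) (u v : U),
     enorm (set_val f (x, u) - set_val f (y, v)) <=
     L * enorm (row_mx (x - y) (set_val u - set_val v)))
  (ell : 'rV[R]_n * U -> R) (h : 'rV[R]_n -> R) (Lell Lh : R)
  (ell_lipschitz : forall (x y : 'rV[R]_n) (u : U),
     `|ell (x, u) - ell (y, u)| <= Lell * enorm (x - y))
  (h_lipschitz : forall x y : 'rV[R]_n, `|h x - h y| <= Lh * enorm (x - y))
  (piN : nat -> probability (borel f) R)
  (* standing assumptions *)
  (cauchy_problem : forall g (s : R) x0 u, X g -> s \in `[0, T] ->
     admissible T s u -> unique_solution T g s x0 u)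
  (running_integrable : forall g (s : R) x0 u, X g -> s \in `[0, T] ->
     admissible T s u ->
     (@completed_lebesgue_measure R).-integrable `[s, T]%classic
       (fun t => (running_cost T ell g s x0 u t)%:E))
  (cost_integrable : forall N (s : R) x0 u, s \in `[0, T] -> admissible T s u ->
     (piN N).-integrable [set: borel f]
       (fun g => (cost T ell h (set_val g) s x0 u)%:E))
  (value_finite : forall (s : R) x0, s \in `[0, T] ->
     value T ell h (set_val f) s x0 \is a fin_num)
  (avg_value_finite : forall N (s : R) x0, s \in `[0, T] ->
     avg_value T ell h (piN N) s x0 \is a fin_num)
  (W1_cvg : W1 (piN N) \d_(f : borel f) @[N --> \oo] --> 0%E) :
  {uniform (`[0, T] `*` [set: 'rV[R]_n]),
    (fun (N : nat) (p : R * 'rV[R]_n) =>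
       fine (avg_value T ell h (piN N) p.1 p.2)) @ \oo -->
    (fun p : R * 'rV[R]_n => fine (value T ell h (set_val f) p.1 p.2))}.
Proof.
have [L fL] := f_lipschitz; have [u0 Uu0] := U_nonempty.
have sd_ge (g1 g2 : X) z :
    ((enorm (set_val g1 z - set_val g2 z))%:E <= sup_dist (set_val g1) (set_val g2))%E.
  by apply: ereal_sup_ubound; exists z.
have sd0 (g1 g2 : X) : (0 <= sup_dist (set_val g1) (set_val g2))%E.
  apply: le_trans (sd_ge g1 g2 (0, SigSub (mem_set Uu0))).
  by rewrite lee_fin enorm_ge0.
have sd_fin (g1 g2 : X) : sup_dist (set_val g1) (set_val g2) \is a fin_num.
  by rewrite ge0_fin_numE//; apply: X_finite; exact: set_valP.
(* Absolute values make the Lipschitz constants nonnegative and the summand 1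
   makes [C] invertible. *)
pose C := (`|Lell| * T + `|Lh|) * (expR (`|L| * T) * T) + 1.
have C0 : 0 < C.
  rewrite ltr_wpDl// mulr_ge0// ?addr_ge0// mulr_ge0// ?ltW ?expR_gt0//.
have costC (g : X) s x0 u : s \in `[0, T] -> admissible T s u ->
    (`|cost T ell h (set_val g) s x0 u - cost T ell h (set_val f) s x0 u|%:E <=
      C%:E * sup_dist (set_val g) (set_val f))%E.
  move=> sT adm; rewrite -(fineK (sd_fin g f)) -EFinM lee_fin.
  have K0 : 0 <= fine (sup_dist (set_val g) (set_val f)) by rewrite fine_ge0.
  have Xg : X (set_val g) by exact: set_valP.
  have Xf : X (set_val f) by exact: set_valP.
  apply: le_trans (cost_dist T (set_val g) (set_val f) ell h s x0 u
    (fine (sup_dist (set_val g) (set_val f))) `|L| `|Lell| `|Lh| _ _ _ _ _ _ _ _ _ _ _ _ _) _ => //.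
  - by move=> z; rewrite -lee_fin fineK.
  - move=> x1 x2 v; apply: le_trans (fL x1 x2 v v) _.
    by rewrite subrr enorm_row_mx0 ler_wpM2r ?enorm_ge0// ler_norm.
  - move=> x1 x2 v; apply: le_trans (ell_lipschitz x1 x2 v) _.
    by rewrite ler_wpM2r ?enorm_ge0// ler_norm.
  - move=> x1 x2; apply: le_trans (h_lipschitz x1 x2) _.
    by rewrite ler_wpM2r ?enorm_ge0// ler_norm.
  - exact: cauchy_problem.
  - exact: cauchy_problem.
  - exact: running_integrable.
  - exact: running_integrable.
  - by rewrite ler_wpM2r// lerDl.
move=> P /uniform_nbhs[E [entE EP]].
move: entE; rewrite -entourage_ballE => -[e/= e0 eE].
have e20 : 0 < e / 2 by rewrite divr_gt0.
have /W1_cvg W1e : nbhs 0%E [set y : \bar R | (y < (e / 2 / C)%:E)%E].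
  by apply: open_nbhs_nbhs; split; [exact: open_ereal_lt_ereal | rewrite /= lte_fin divr_gt0].
near=> N; apply: EP => -[s x0] [/= sT _]; apply: eE => /=.
have sT' : s \in `[0, T] by [].
rewrite /ball/= distrC.
apply: (@le_lt_trans _ _ (e / 2)); last by rewrite ltr_pdivrMr// ltr_pMr// ltr1n.
apply: ereal_inf_dist; [|exact: avg_value_finite|exact: value_finite].
move=> u adm; rewrite -lee_fin.
apply: le_trans (mean_dist_le_W1 (piN N) (fun g => cost T ell h (set_val g) s x0 u) C C0 _ _ sd0) _.
- exact: cost_integrable.
- by move=> g; exact: costC.
- rewrite -lee_pdivlMl// -EFinM mulrC; apply/ltW; near: N; exact: W1e.
Unshelve. all: by end_near. Qed.
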